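(* Let $G=(V,E,w)$ be a finite connected graph with $|V|=n\ge2$ and weights $w:E\to\mathbb{R}_{>0}$. Then $$\operatorname{OPT}_D^-(G,w)=\operatorname{OPT}_{\mathrm{card}}(G,w)=\min_{T\in\mathcal T_{\mathrm{conn}}^{\mathrm{bin}}(G)}\ \sum_{xy\in E}w_{xy}h_T(x,y).$$ Moreover, for every $T\in\mathcal T_{\mathrm{conn}}^{\mathrm{bin}}(G)$ and all distinct $x,y\in V$, $$d_G(x,y)\le\operatorname{diam}_{d_G}\bigl(C_T(x,y)\bigr)\le|C_T(x,y)|-1=h_T(x,y)$$ (for $x=y$ all terms are $0$). Thus $h_T\ge d_G$ on all pairs in $V\times V$, not only on the edges.
   Context: $d_G$ is the shortest-path metric of the support graph $(V,E)$ with every edge of length $1$; the weights are not edge lengths. $\operatorname{diam}_{d_G}(S)=\max_{a,b\in S}d_G(a,b)$. A rooted binary hierarchy $T$ on $V$ is a rooted tree whose leaves are the vertices of $V$ and whose internal nodes have exactly two children; each node is identified with the set of leaves in its subtree (a cluster), and $C_T(x,y)$ is the cluster of the lowest common ancestor of $x,y$ (so $C_T(x,x)=\{x\}$). $\mathcal T_{\mathrm{bin}}(V)$ is the set of all rooted binary hierarchies on $V$, and $\mathcal T_{\mathrm{conn}}^{\mathrm{bin}}(G)$ the subset of those all of whose clusters induce connected subgraphs of $G$. The shifted cardinality labeling is $h_T(x,x)=0$ and $h_T(x,y)=|C_T(x,y)|-1$ for $x\neq y$. $\operatorname{OPT}_D^-(G,w)=\min_{T\in\mathcal T_{\mathrm{bin}}(V)}\sum_{xy\in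 E}w_{xy}(|C_T(x,y)|-1)$ is the shifted Dasgupta optimum. $\operatorname{OPT}_{\mathrm{card}}(G,w)$ is the minimum of $\sum_{xy\in E}w_{xy}h_H(x,y)$ over all $H\in\mathcal T_{\mathrm{bin}}(V)$ with $h_H(x,y)\ge d_G(x,y)$ for all $x,y\in V$. *)

(* Defs.v *)
From mathcomp Require Import all_boot all_order all_algebra.
From mathcomp Require Import reals.

Set Implicit Arguments.
Unset Strict Implicit.
Unset Printing Implicit Defensive.

Import Order.TTheory GRing.Theory Num.Theory.

Record connGraph (V : finType) := ConnGraph {
  adj :> rel V;
  adj_sym : symmetric adj;
  adj_irr : irreflexive adj;
  adj_conn : forall x y, connect adj x y }.

Section Graph.
Variables (V : finType) (G : connGraph V).

Definition walk (k : nat) (x y : V) : bool :=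
  [exists p : k.-tuple V, path G x p && (last x p == y)].

Lemma walk_ex (x y : V) : exists k, walk k x y.
Proof.
have /connectP[p Gp ->] := adj_conn G x y.
by exists (size p); apply/existsP; exists (in_tuple p); rewrite Gp eqxx.
Qed.

Definition dist (x y : V) : nat := ex_minn (walk_ex x y).

Definition diam (S : {set V}) : nat := \max_(a in S) \max_(b in S) dist a b.

Definition induces_connected (S : {set V}) : bool :=
  [forall x in S, forall y in S,
     connect [rel u v | [&& u \in S, v \in S & G u v]] x y].

End Graph.

(* A hierarchy is represented by a planar binary tree: exchanging the two
   children of a node changes the term but none of its clusters. *)
Inductive btree (V : Type) : Type :=
  | Leaf of V
  | Node of btree V & btree V.

Fixpoint leaves (V : Type) (t : btree V) : seq V :=
  match t with
  | Leaf v => [:: v]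
  | Node l r => leaves l ++ leaves r
  end.

Fixpoint nodes (V : Type) (t : btree V) : seq (btree V) :=
  t :: match t with
       | Leaf _ => [::]
       | Node l r => nodes l ++ nodes r
       end.

Section Hierarchy.
Variable V : finType.
Implicit Types (t : btree V) (x y : V).

Definition Tbin t : bool := perm_eq (leaves t) (enum V).

Definition cluster t : {set V} := [set x in leaves t].

Definition Tconn (G : connGraph V) t : bool :=
  Tbin t && all (fun s => induces_connected G (cluster s)) (nodes t).

(* Descend from the root as long as one child is an ancestor of both leaves;
   meaningful only when x and y are leaves of t (see lcaP). *)
Fixpoint lca t x y : btree V :=
  match t with
  | Leaf _ => t
  | Node l r =>
      if (x \in leaves l) && (y \in leaves l) then lca l x y
      else if (x \in leaves r) && (y \in leaves r) then lca r x y
      else t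
  end.

Definition lca_cluster t x y : {set V} := cluster (lca t x y).

Definition shifted_card t x y : nat :=
  if x == y then 0 else #|lca_cluster t x y| - 1.

Lemma lca_mem t x y : x \in leaves t -> y \in leaves t ->
  (x \in lca_cluster t x y) && (y \in lca_cluster t x y).
Proof.
rewrite /lca_cluster; elim: t => [v|l IHl r IHr] /=.
  by rewrite !inE => -> ->.
move=> xt yt; case: ifP => [/andP[]|_]; first exact: IHl.
by case: ifP => [/andP[]|_]; [apply: IHr | rewrite !inE xt yt].
Qed.

Lemma lca_node t x y :
  exists s1 s2, nodes t = s1 ++ lca t x y :: s2.
Proof.
elim: t => [v|l [s1 [s2 El]] r [s3 [s4 Er]]] /=; first by exists [::], [::].
case: ifP => _.
  by exists (Node l r :: s1), (s2 ++ nodes r); rewrite {1}El /= -catA.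
case: ifP => _; last by exists [::], (nodes l ++ nodes r).
by exists (Node l r :: nodes l ++ s3), s4; rewrite {1}Er /= -catA.
Qed.

Lemma nodes_sub t : all (fun s => cluster s \subset cluster t) (nodes t).
Proof.
elim: t => [v|l IHl r IHr] /=; first by rewrite subxx.
rewrite subxx all_cat /=; apply/andP; split.
  apply: sub_all IHl => s /subset_trans; apply.
  by apply/subsetP => z; rewrite !inE mem_cat => ->.
apply: sub_all IHr => s /subset_trans; apply.
by apply/subsetP => z; rewrite !inE mem_cat orbC => ->.
Qed.

(* The descent does return the lowest common ancestor. *)
Lemma lcaP t x y : uniq (leaves t) ->
  all (fun s => ((x \in cluster s) && (y \in cluster s))
                  ==> (lca_cluster t x y \subset cluster s)) (nodes t).
Proof.
elim: t => [v|l IHl r IHr]; first by rewrite /= /lca_cluster /= subxx implybT.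
rewrite [leaves _]/= cat_uniq => /and3P[Ul /hasPn lr Ur].
have dis z : z \in leaves l -> z \in leaves r -> false.
  by move=> zl /lr; rewrite zl.
have key (a : btree V) :
    ~~ ((x \in leaves a) && (y \in leaves a)) ->
    all (fun s => ((x \in cluster s) && (y \in cluster s))
                  ==> (lca_cluster (Node l r) x y \subset cluster s)) (nodes a).
  move=> nxy; apply: sub_all (nodes_sub a) => s /subsetP sa.
  apply/implyP => /andP[/sa xs /sa ys]; move: xs ys nxy.
  by rewrite !inE => -> ->.
have root : lca_cluster (Node l r) x y \subset cluster (Node l r).
  have [s1 [s2 E]] := lca_node (Node l r) x y.
  by have := nodes_sub (Node l r); rewrite E all_cat /= => /and3P[].
rewrite [nodes _]/= -cat1s !all_cat all_seq1 root implybT /=.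
have [/andP[xl yl]|nl] := boolP ((x \in leaves l) && (y \in leaves l)).
  have nr : ~~ ((x \in leaves r) && (y \in leaves r)).
    by apply/negP => /andP[xr _]; have := dis _ xl xr.
  apply/andP; split; last exact: (key r nr).
  have -> : lca_cluster (Node l r) x y = lca_cluster l x y.
    by rewrite /lca_cluster /= xl yl.
  exact: IHl.
apply/andP; split; first exact: (key l nl).
have [/andP[xr yr]|nr] := boolP ((x \in leaves r) && (y \in leaves r)).
  have -> : lca_cluster (Node l r) x y = lca_cluster r x y.
    by rewrite /lca_cluster /= (negbTE nl) xr yr.
  exact: IHr.
exact: (key r nr).
Qed.

End Hierarchy.

Section Cost.
Local Open Scope ring_scope.
Variables (R : realType) (V : finType) (G : connGraph V) (w : V -> V -> R).

(* Each undirected edge is counted once, with its smaller endpoint (in the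
   enumeration of V) first; used only for w and f symmetric on edges. *)
Definition edge_sum (f : V -> V -> R) : R :=
  \sum_(p : V * V | G p.1 p.2 && (enum_rank p.1 < enum_rank p.2)%N)
     w p.1 p.2 * f p.1 p.2.

Definition dasgupta_cost (t : btree V) : R :=
  edge_sum (fun x y => #|lca_cluster t x y|%:R - 1).

Definition card_cost (t : btree V) : R :=
  edge_sum (fun x y => (shifted_card t x y)%:R).

Definition is_min (P : btree V -> Prop) (f : btree V -> R) (m : R) : Prop :=
  (exists2 t, P t & f t = m) /\ (forall t, P t -> m <= f t).

Definition is_OPT_D (m : R) : Prop := is_min (@Tbin V) dasgupta_cost m.

Definition is_OPT_card (m : R) : Prop :=
  is_min (fun t => Tbin t /\ forall x y, (dist G x y <= shifted_card t x y)%N)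
         card_cost m.

Definition is_OPT_conn (m : R) : Prop := is_min (Tconn G) card_cost m.

End Cost.

(* Main.v *)
(** For a binary hierarchy T, the connected components of the subgraphs induced
    by the clusters of T form a laminar family in which the least member
    containing both ends of an edge xy lies inside C_T(x,y).  Refining this
    family to a binary hierarchy with connected clusters therefore does not
    increase |C_T(x,y)| for any edge, so the three minima coincide.  The metric
    inequality holds because a duplicate-free path inside a connected cluster C
    has at most |C| - 1 edges. *)
Require Import Defs.
From mathcomp Require Import all_boot all_order all_algebra.
From mathcomp Require Import boolp reals.

Set Implicit Arguments.
Unset Strict Implicit.
Unset Printing Implicit Defensive.

Import Order.TTheory GRing.Theory Num.Theory.

(** * Induced subgraphs: components, splitting, distances *)

Section Induced.
Variables (V : finType) (G : connGraph V).
Implicit Types (S A B : {set V}) (x y z : V).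

Definition induced S : rel V := [rel u v | [&& u \in S, v \in S & G u v]].

(** For [x] outside [S] this is the singleton of [x], since [connect] is reflexive; hence the
    hypothesis [x \in S] in the lemmas on components. *)
Definition component S x : {set V} := [set y | connect (induced S) x y].

Lemma induced_connectedP S :
  reflect {in S &, forall x y, connect (induced S) x y} (induces_connected G S).
Proof.
apply: (iffP forall_inP) => [cS x y xS yS | cS x xS].
  by have /forall_inP := cS x xS; apply.
by apply/forall_inP => y yS; apply: cS.
Qed.

Lemma induced_sym S : connect_sym (induced S).
Proof.
by apply: sym_connect_sym => x y; rewrite /induced /= adj_sym andbCA.
Qed.

Lemma induced_connectS A B x y :
  A \subset B -> connect (induced A) x y -> connect (induced B) x y.
Proof.
move=> /subsetP sAB; apply: connect_sub => u v /and3P[uA vA uv].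
by apply: connect1; rewrite /induced /= !sAB.
Qed.

Lemma component_sub S x : x \in S -> component S x \subset S.
Proof.
move=> xS; apply/subsetP => y; rewrite inE => /connectP[p].
elim: p x xS => [|z p IHp] x xS /=; first by move=> _ ->.
by case/andP=> /and3P[_ zS _] /IHp; apply.
Qed.

Lemma component_refl S x : x \in component S x.
Proof. by rewrite inE. Qed.

Lemma component_closed S x y z : x \in S ->
  y \in component S x -> z \in S -> G y z -> z \in component S x.
Proof.
move=> xS yK zS yz; have yS := subsetP (component_sub xS) y yK.
move: yK; rewrite !inE => /connect_trans; apply.
by apply: connect1; rewrite /induced /= yS zS.
Qed.

Lemma component_connected S x : x \in S -> induces_connected G (component S x).
Proof.
move=> xS.
have path_in y : y \in component S x -> connect (induced (component S x)) x y.
  rewrite inE => /connectP[p pth ->].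
  (* Peeling off the last edge keeps the start [x] fixed, so the end of every prefix is again in the
     component of [x]. *)
  elim/last_ind: p pth => [|p z IHp]; first by [].
  rewrite rcons_path last_rcons => /andP[pth e].
  apply: connect_trans (IHp pth) _; apply: connect1.
  have lK : last x p \in component S x by rewrite inE; apply/connectP; exists p.
  case/and3P: e => _ zS e.
  by rewrite /induced /= lK (component_closed xS lK zS e).
apply/induced_connectedP => y z /path_in xy /path_in.
by apply: connect_trans; rewrite induced_sym.
Qed.

(** A path inside [S] that starts at [x] can never leave [A], and such paths reach all of [S]. *)
Lemma connected_closed S A x : induces_connected G S -> A \subset S ->
  x \in A -> (forall y z, y \in A -> z \in S -> G y z -> z \in A) -> A = S.
Proof.
move=> /induced_connectedP cS sAS xA clA; apply/eqP.
rewrite eqEsubset sAS; apply/subsetP => y yS.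
have /connectP[p] := cS x y (subsetP sAS x xA) yS.
elim: p x xA => [|z p IHp] x xA /=; first by move=> _ ->.
by case/andP=> /and3P[_ zS xz]; apply/IHp/(clA x).
Qed.

(* B is a component of S :\: A: the other components stay attached to A. *)
Lemma connected_split S A x y :
  induces_connected G S -> induces_connected G A -> A \subset S ->
  x \in A -> y \in S :\: A ->
  exists B : {set V},
    [/\ y \in B, B \subset S :\: A, induces_connected G B,
        induces_connected G (S :\: B)
      & forall u v, u \in B -> v \in S :\: B -> G u v -> v \in A].
Proof.
move=> cS cA sAS xA yD; pose B := component (S :\: A) y.
have sB : B \subset S :\: A by apply: component_sub.
have sBS : B \subset S := subset_trans sB (subsetDl _ _).
have edge u v : u \in B -> v \in S :\: B -> G u v -> v \in A.
  move=> uB /setDP[vS vB] uv; apply: contraNT vB => vA.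
  by apply: (component_closed yD uB) uv; rewrite inE vA.
have sAD : A \subset S :\: B.
  apply/subsetP => z zA; rewrite inE (subsetP sAS) // andbT.
  by apply: contraL zA => /(subsetP sB); rewrite inE => /andP[].
have xD := subsetP sAD x xA.
exists B; split=> //; [exact: component_refl | exact: component_connected |].
(* If [B] and the component of [x] in [S :\: B] exhaust [S], then [S :\: B] equals that component
   and is connected. *)
suff E : component (S :\: B) x :|: B = S.
  have <- : component (S :\: B) x = S :\: B; last exact: component_connected.
  apply/eqP; rewrite eqEsubset component_sub //=; apply/subsetP => z.
  by case/setDP; rewrite -{1}E => /setUP[//|->].
apply: (connected_closed (x := x) cS).
- by rewrite subUset sBS (subset_trans (component_sub xD)) ?subsetDl.
- by rewrite inE component_refl.
move=> u v uKB vS uv; apply/setUP.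
have [vB|vB] := boolP (v \in B); first by right.
left; have vD : v \in S :\: B by apply/setDP.
case/setUP: uKB => [uK|uB]; first exact: (component_closed xD uK vD uv).
(* An edge leaving [B] ends in [A], which is connected, avoids [B] and contains [x]; its end is thus
   joined to [x] inside [S :\: B]. *)
have vA : v \in A by apply: (edge u).
by rewrite inE (induced_connectS sAD) //; apply: (induced_connectedP _ cA).
Qed.

Lemma dist_le_size x p : path G x p -> (dist G x (last x p) <= size p)%N.
Proof.
move=> Gp; rewrite /dist; case: ex_minnP => m _; apply.
by apply/existsP; exists (in_tuple p); rewrite /= Gp eqxx.
Qed.

Lemma distxx x : dist G x x = 0%N.
Proof. by apply/eqP; rewrite -leqn0; apply: (@dist_le_size x [::]). Qed.

Lemma dist_connected S x y : induces_connected G S ->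
  x \in S -> y \in S -> (dist G x y <= #|S| - 1)%N.
Proof.
move=> /induced_connectedP cS xS yS; have /connectP[p pth ->] := cS x y xS yS.
case/shortenP: pth => q pth Uq _.
have Gq : path G x q by apply: sub_path pth => u v /and3P[].
have qS : {subset x :: q <= S}.
  move=> z; rewrite inE => /predU1P[-> //|].
  elim: q x pth {xS Uq Gq} => //= v q IHq u /andP[/and3P[_ vS _] /IHq qS].
  by rewrite inE => /predU1P[-> //|/qS].
apply: leq_trans (dist_le_size Gq) _.
(* The shortened path visits [(size q).+1] distinct vertices of [S]; the truncated predecessor is
   exact because [x] is in [S]. *)
rewrite -ltnS subn1 prednK; last by apply/card_gt0P; exists x.
rewrite -[(size q).+1]/(size (x :: q)) -(card_uniqP Uq).
exact/subset_leq_card/subsetP.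
Qed.

Lemma dist_le_diam S x y : x \in S -> y \in S -> (dist G x y <= diam G S)%N.
Proof.
move=> xS yS.
apply: leq_trans (leq_bigmax_cond (F := fun a => \max_(b in S) dist G a b) x xS).
exact: (leq_bigmax_cond (F := dist G x)).
Qed.

Lemma diam_connected S : induces_connected G S -> (diam G S <= #|S| - 1)%N.
Proof.
move=> cS; apply/bigmax_leqP => x xS; apply/bigmax_leqP => y yS.
exact: dist_connected.
Qed.

End Induced.

(** * Clusters of lowest common ancestors in binary trees *)

Section Trees.
Variable V : finType.
Implicit Types (t : btree V) (S : {set V}) (x y : V).

Lemma lca_cluster_sub t x y : lca_cluster t x y \subset cluster t.
Proof.
have [s1 [s2 E]] := lca_node t x y.
by have := nodes_sub t; rewrite E all_cat /= => /and3P[].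
Qed.

Lemma lca_cluster_diag t x : x \in leaves t -> lca_cluster t x x = [set x].
Proof.
elim: t => [v|l IHl r IHr].
  by rewrite inE => /eqP->; apply/setP => z; rewrite !inE.
rewrite /= mem_cat /lca_cluster /= !andbb.
by case: ifP => [/IHl //|_] /= xr; rewrite xr; apply: IHr.
Qed.

Lemma cluster_Node (l r : btree V) :
  cluster (Node l r) = cluster l :|: cluster r.
Proof. by apply/setP => z; rewrite !inE mem_cat. Qed.

Lemma lca_cluster_l l r x y : x \in cluster l -> y \in cluster l ->
  lca_cluster (Node l r) x y = lca_cluster l x y.
Proof. by rewrite !inE /lca_cluster /= => -> ->. Qed.

Lemma lca_cluster_r l r x y : x \in cluster r -> y \in cluster r ->
  x \notin cluster l -> lca_cluster (Node l r) x y = lca_cluster r x y.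
Proof. by rewrite !inE /lca_cluster /= => -> -> /negbTE->. Qed.

Lemma lca_cluster_root l r x y : x \notin cluster l -> y \notin cluster r ->
  lca_cluster (Node l r) x y = cluster (Node l r).
Proof. by rewrite !inE /lca_cluster /= => /negbTE-> /negbTE->; rewrite andbF. Qed.

Lemma lca_cluster_sym t x y : lca_cluster t x y = lca_cluster t y x.
Proof.
by rewrite /lca_cluster; congr cluster; elim: t => //= l -> r ->;
   rewrite [in LHS]andbC [X in if _ then _ else if X then _ else _]andbC.
Qed.

Lemma uniq_Node (l r : btree V) : uniq (leaves (Node l r)) =
  [&& uniq (leaves l), [disjoint cluster l & cluster r] & uniq (leaves r)].
Proof.
rewrite /= cat_uniq; congr [&& _, _ & _].
rewrite -setI_eq0; apply/hasPn/eqP => [H | H z zr].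
  apply/setP => z; rewrite !inE; apply/negbTE/negP => /andP[zl /H].
  by rewrite zl.
by apply/negP => zl; have := in_set0 z; rewrite -H !inE zl zr.
Qed.

(** A caterpillar tree does it; it provides a first hierarchy, so that the minima range over
    nonempty sets. *)
Lemma btree_of_seq (s : seq V) : s != [::] -> exists t, leaves t = s.
Proof.
elim: s => // x [|y s] IHs _; first by exists (Leaf x).
by have [//|t Et] := IHs; exists (Node (Leaf x) t); rewrite /= Et.
Qed.

Lemma Tbin_cluster t : Tbin t -> cluster t = setT.
Proof.
by move=> /perm_mem tE; apply/setP => z; rewrite !inE tE mem_enum.
Qed.

Lemma shifted_cardN t x y : x != y ->
  shifted_card t x y = (#|lca_cluster t x y| - 1)%N.
Proof. by rewrite /shifted_card => /negbTE->. Qed.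

Lemma lca_Tbin t x y : Tbin t ->
  (x \in lca_cluster t x y) && (y \in lca_cluster t x y).
Proof. by move=> /perm_mem tE; rewrite lca_mem // tE mem_enum. Qed.

End Trees.

(** * Replacing a hierarchy by one with connected clusters *)

Section Connectivization.
Variables (V : finType) (G : connGraph V).
Implicit Types (t u : btree V) (S : {set V}) (x y : V).

Definition conn_nodes t :=
  all (fun s => induces_connected G (cluster s)) (nodes t).

Lemma induces_connected1 x : induces_connected G [set x].
Proof. by apply/induced_connectedP => y z /set1P-> /set1P->. Qed.

Lemma conn_nodes_Node t u : conn_nodes (Node t u) =
  [&& induces_connected G (cluster (Node t u)), conn_nodes t & conn_nodes u].
Proof. by rewrite /conn_nodes /= all_cat. Qed.

(** Generalizing from the whole vertex set to a connected [S] inside [cluster t] makes the recursion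
    possible. The inclusion is restricted to edges: nonadjacent vertices may share a small
    disconnected cluster of [t], which no connected cluster can match. *)
Lemma connectivize_on t S : uniq (leaves t) -> S \subset cluster t ->
  S != set0 -> induces_connected G S ->
  exists u, [/\ cluster u = S, uniq (leaves u), conn_nodes u
    & {in S &, forall x y, G x y ->
         lca_cluster u x y \subset lca_cluster t x y}].
Proof.
elim: t S => [v|l IHl r IHr] S.
  move=> _ sSv S0 cS.
  have Ev : cluster (Leaf v) = [set v] by apply/setP => z; rewrite !inE.
  have ES : S = [set v].
    by move: sSv; rewrite Ev subset1 (negbTE S0) orbF => /eqP.
  exists (Leaf v); rewrite ES; split=> //.
  by rewrite /conn_nodes /= Ev andbT induces_connected1.
rewrite uniq_Node => /and3P[Ul dlr Ur].
have notr z : z \in cluster l -> z \notin cluster r.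
  by move/(disjointFr dlr) => ->.
have notl z : z \in cluster r -> z \notin cluster l.
  by move/(disjointFl dlr) => ->.
(* If [S] lies below one child, the induction on [t] applies. Otherwise [Node l r] is kept and [S]
   is split into two smaller connected parts, by an inner induction on its size. *)
have [n] := ubnP #|S|; elim: n S => // n IHn S ltSn sS S0 cS.
have [sSl|/subsetPn[y yS yl]] := boolP (S \subset cluster l).
  have [u [uS Uu cu lcau]] := IHl S Ul sSl S0 cS.
  exists u; split=> // x y xS yS.
  by rewrite lca_cluster_l ?(subsetP sSl) //; apply: lcau.
have [sSr|/subsetPn[x xS xr]] := boolP (S \subset cluster r).
  have [u [uS Uu cu lcau]] := IHr S Ur sSr S0 cS.
  exists u; split=> // x z xS zS.
  have xr := subsetP sSr x xS.
  by rewrite lca_cluster_r ?(subsetP sSr) ?notl //; apply: lcau.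
have xl : x \in cluster l.
  by have := subsetP sS x xS; rewrite cluster_Node inE (negbTE xr) orbF.
(* No edge joins A to the rest of S inside cluster l, so every edge between the
   two parts B and S :\: B found below joins cluster l to cluster r. *)
pose A := component G (S :&: cluster l) x.
have xSl : x \in S :&: cluster l by rewrite inE xS.
have sASl : A \subset S :&: cluster l by apply: component_sub.
have [sAS sAl] := subsetIP sASl.
have yD : y \in S :\: A by rewrite inE yS (contra (subsetP sAl y)).
have cA : induces_connected G A by apply: component_connected.
have xA : x \in A := component_refl G _ x.
have [B [yB sB cB cD cross]] := connected_split cS cA sAS xA yD.
have sBS : B \subset S := subset_trans sB (subsetDl _ _).
have xD : x \in S :\: B.
  by rewrite inE xS andbT; apply: contraL xA => /(subsetP sB)/setDP[].
have lt1 : (#|B| < n)%N.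
  rewrite -ltnS; apply: leq_trans ltSn; rewrite !ltnS; apply: proper_card.
  by apply/properP; split=> //; exists x => //; case/setDP: xD.
have lt2 : (#|S :\: B| < n)%N.
  rewrite -ltnS; apply: leq_trans ltSn; rewrite !ltnS; apply: proper_card.
  by apply/properP; split; [exact: subsetDl | exists y; rewrite // inE yB].
have B0 : B != set0 by apply/set0Pn; exists y.
have D0 : S :\: B != set0 by apply/set0Pn; exists x.
have [u1 [u1S Uu1 cu1 lca1]] :=
  IHn B lt1 (subset_trans sBS sS) B0 cB.
have [u2 [u2S Uu2 cu2 lca2]] := IHn (S :\: B) lt2
  (subset_trans (subsetDl _ _) sS) D0 cD.
have uS : cluster (Node u1 u2) = S.
  by rewrite cluster_Node u1S u2S -{1}(setIidPr sBS) setID.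
have lca_full a b : a \in B -> b \in S :\: B -> G a b ->
    lca_cluster (Node l r) a b = cluster (Node l r).
  move=> aB bD ab; have bA := cross a b aB bD ab.
  apply: lca_cluster_root; last by apply: notr; apply: (subsetP sAl).
  have /setDP[aS aA] := subsetP sB a aB; apply: contra aA => al.
  by apply: (component_closed xSl bA); rewrite 1?inE ?aS // adj_sym.
have sub_full a b : lca_cluster (Node u1 u2) a b \subset cluster (Node l r).
  by apply: subset_trans (lca_cluster_sub _ _ _) _; rewrite uS.
exists (Node u1 u2); split=> //.
- by rewrite uniq_Node Uu1 Uu2 u1S u2S -setI_eq0 setIDA setDIl setDv set0I eqxx.
- by rewrite conn_nodes_Node uS cS cu1.
move=> a b aS bS ab.
(* An edge within one part is handled by the tree of that part. A crossing edge already has the full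
   root cluster in [Node l r], so any cluster of the new tree fits in it. *)
have [aB|aB] := boolP (a \in B); have [bB|bB] := boolP (b \in B).
- by rewrite lca_cluster_l ?u1S //; apply: lca1.
- by rewrite lca_full // inE bB.
- by rewrite (lca_cluster_sym (Node l r)) lca_full ?inE ?aB // adj_sym.
- have aD : a \in S :\: B by rewrite inE aB.
  have bD : b \in S :\: B by rewrite inE bB.
  by rewrite lca_cluster_r ?u1S ?u2S //; apply: lca2.
Qed.

Lemma induces_connectedT : induces_connected G setT.
Proof.
apply/induced_connectedP => x y _ _.
by rewrite (eq_connect (e' := G)) ?adj_conn // => u v; rewrite /induced /= !inE.
Qed.

Lemma connectivize t : (0 < #|V|)%N -> Tbin t ->
  exists2 u, Tconn G u &
    forall x y, G x y -> lca_cluster u x y \subset lca_cluster t x y.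
Proof.
move=> /card_gt0P[x _] tT.
have Ut : uniq (leaves t) by rewrite (perm_uniq tT) enum_uniq.
have [||u [uT Uu cu lcau]] := connectivize_on Ut _ _ induces_connectedT.
- by rewrite (Tbin_cluster tT).
- by apply/set0Pn; exists x.
exists u; last by move=> a b; apply: lcau.
rewrite /Tconn; apply/andP; split; last exact: cu.
apply: uniq_perm (enum_uniq V) _ => // z.
by have := in_setT z; rewrite -uT inE mem_enum => ->.
Qed.

Lemma Tbin_exists : (0 < #|V|)%N -> exists t : btree V, Tbin t.
Proof.
rewrite cardE => V_gt0; have [|t Et] := @btree_of_seq V (enum V).
  by rewrite -size_eq0 -lt0n.
by exists t; rewrite /Tbin Et.
Qed.

Lemma Tconn_lca t x y : Tconn G t -> induces_connected G (lca_cluster t x y).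
Proof.
case/andP=> _; have [s1 [s2 ->]] := lca_node t x y.
by rewrite all_cat /= => /and3P[].
Qed.

Lemma dist_le_shifted_card t x y : Tconn G t ->
  (dist G x y <= shifted_card t x y)%N.
Proof.
move=> ct; have /andP[tT _] := ct.
have [->|xy] := eqVneq x y; first by rewrite distxx.
have /andP[xC yC] := lca_Tbin x y tT.
by rewrite shifted_cardN //; apply: dist_connected => //; apply: Tconn_lca.
Qed.

End Connectivization.

(** * Comparison of costs and attainment of minima *)

Section Costs.
Local Open Scope ring_scope.
Variables (R : realType) (V : finType) (G : connGraph V) (w : V -> V -> R).

Lemma edge_sum_eq f g : (forall x y, G x y -> f x y = g x y) ->
  edge_sum G w f = edge_sum G w g.
Proof. by move=> fg; apply: eq_bigr => p /andP[/fg->]. Qed.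

Lemma edge_sum_le f g : (forall x y, G x y -> 0 <= w x y) ->
  (forall x y, G x y -> f x y <= g x y) -> edge_sum G w f <= edge_sum G w g.
Proof.
move=> w_ge0 fg; apply: ler_sum => p /andP[Gp _].
by rewrite ler_wpM2l ?w_ge0 ?fg.
Qed.

(** One cost subtracts 1 in [nat], the other in [R]; they agree because clusters are nonempty and
    edges have distinct ends. *)
Lemma card_costE t : Tbin t -> card_cost G w t = dasgupta_cost G w t.
Proof.
move=> tT; apply: edge_sum_eq => x y xy.
have /andP[xC _] := lca_Tbin x y tT.
rewrite shifted_cardN; last by apply: contraTneq xy => ->; rewrite adj_irr.
by rewrite natrB //; apply/card_gt0P; exists x.
Qed.

(** For minimizing over the type [btree V], which is not finite: the minimum is taken over the
    values of [f] attained on [P], a subset of the finite type [I] selected classically. *)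
Lemma finite_min (T : Type) (I : finType) (P : T -> Prop) (f : T -> I)
    (F : I -> R) t0 : P t0 ->
  exists2 t, P t & forall u, P u -> F (f t) <= F (f u).
Proof.
move=> Pt0; pose Q i := `[< exists2 t, P t & f t = i >].
have Qf u : P u -> Q (f u) by move=> Pu; apply/asboolP; exists u.
case: (Order.TotalTheory.arg_minP F (Qf t0 Pt0)) => i /asboolP[t Pt <-] min_t.
by exists t => // u /Qf/min_t.
Qed.

Lemma card_cost_min (P : btree V -> Prop) t0 : P t0 ->
  exists2 t, P t & forall u, P u -> card_cost G w t <= card_cost G w u.
Proof.
(* The cost depends on [t] only through its table of labels. Each label is at most [#|V|], so
   [inord] loses nothing. *)
pose f t : {ffun V * V -> 'I_#|V|.+1} :=
  [ffun p => inord (shifted_card t p.1 p.2)].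
pose F (h : {ffun V * V -> 'I_#|V|.+1}) :=
  edge_sum G w (fun x y => (h (x, y) : nat)%:R).
have E t : card_cost G w t = F (f t).
  apply: edge_sum_eq => x y _; rewrite ffunE inordK //= ltnS /shifted_card.
  by case: ifP => // _; apply: leq_trans (leq_subr _ _) (max_card _).
move=> /(finite_min f F)[t Pt min_t]; exists t => // u.
by rewrite !E; apply: min_t.
Qed.

End Costs.

(** * Equality of the three optima and the metric bounds *)

Theorem corollary4 (R : realType) (V : finType) (G : connGraph V)
    (w : V -> V -> R)
    (V_ge2 : (2 <= #|V|)%N)
    (w_sym : forall x y : V, G x y -> w x y = w y x)
    (w_gt0 : forall x y : V, G x y -> (0 < w x y)%R) :
  (exists m : R,
     [/\ is_OPT_D G w m, is_OPT_card G w m & is_OPT_conn G w m]) /\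
  (forall T : btree V, Tconn G T ->
     [/\ forall x y : V, x != y ->
           [/\ (dist G x y <= diam G (lca_cluster T x y))%N,
               (diam G (lca_cluster T x y) <= #|lca_cluster T x y| - 1)%N
             & (#|lca_cluster T x y| - 1)%N = shifted_card T x y],
         forall x : V,
           [/\ dist G x x = 0%N, diam G (lca_cluster T x x) = 0%N,
               (#|lca_cluster T x x| - 1)%N = 0%N
             & shifted_card T x x = 0%N]
       & forall x y : V, (dist G x y <= shifted_card T x y)%N]).

Proof.
have V_gt0 : (0 < #|V|)%N by apply: ltnW.
split=> [|T cT]; last first.
  have /andP[bT _] := cT.
  split=> [x y xy | x | x y]; last exact: dist_le_shifted_card.
    have /andP[xC yC] := lca_Tbin x y bT.
    split; [exact: dist_le_diam | | by rewrite shifted_cardN].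
    exact/diam_connected/Tconn_lca.
  have xT : x \in leaves T by rewrite (perm_mem bT) mem_enum.
  rewrite lca_cluster_diag // cards1 /shifted_card eqxx distxx.
  by rewrite /diam !big_set1 distxx.
have [t0 /(connectivize G V_gt0)[t1 ct1 _]] := Tbin_exists V_gt0.
have [t ct min_t] := card_cost_min G w (P := Tconn G) ct1.
have /andP[bt _] := ct.
(* Connectivizing [u] shrinks the cluster of every edge, and positive weights turn this into a cost
   no larger than that of [u]. *)
have min_bin u : Tbin u -> (card_cost G w t <= dasgupta_cost G w u)%R.
  move=> /(connectivize G V_gt0)[v cv sub_vu]; have /andP[bv _] := cv.
  apply: le_trans (min_t v cv) _; rewrite card_costE //.
  apply: edge_sum_le => [x y /w_gt0/ltW //|x y xy].
  by rewrite lerD2r ler_nat subset_leq_card ?sub_vu.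
(* Connected hierarchies satisfy the metric constraint, and the constrained ones are binary
   hierarchies; as [t] lies in the smallest class and is optimal in the largest, it is optimal in
   all three. *)
exists (card_cost G w t); split; split=> //.
- by exists t; rewrite -?card_costE.
- by exists t => //; split=> // x y; apply: dist_le_shifted_card.
- by move=> u [bu _]; rewrite (card_costE _ _ bu); apply: min_bin.
- by exists t.
Qed.
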